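(* Let $\mathfrak g$ be a $4$-dimensional metric nilpotent Lie algebra with a two-dimensional derived algebra. Then there is an orthonormal basis $\{X_1,X_2,X_3,X_4\}$ of $\mathfrak g$ such that the defining relations for $\mathfrak g$ are $$[X_1,X_2]=\alpha X_3+\beta X_4,\qquad [X_1,X_3]=\gamma X_4$$ (all other brackets of basis elements being zero, up to antisymmetry), where $\alpha,\beta,\gamma\in\mathbb R$ and $\alpha,\gamma>0$. Furthermore, with respect to such a basis: (a) the set of geodesic vectors is the set of nonzero vectors in the union of the subspace $\operatorname{Span}(X_1,X_2)$, which is orthogonal to the derived algebra, and the cone $\{xX_2+yX_3+zX_4 : x,y,z\in\mathbb R,\ \alpha xy+\beta xz+\gamma yz=0\}\subseteq\operatorname{Span}(X_2,X_3,X_4)$; (b) if $\mathfrak g$ has a $2$-dimensional totally geodesic subalgebra $\mathfrak h$, then $\beta=0$ and in this case, either $\mathfrak h=\operatorname{Span}(X_2,X_4)$ or $\mathfrak h=\operatorname{Span}(\gamma X_2-\alpha X_4,X_3)$.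
   Context: All Lie algebras are finite-dimensional and over $\mathbb R$. A metric Lie algebra is a Lie algebra $\mathfrak g$ equipped with an inner product $\langle\cdot,\cdot\rangle$ (arbitrary; no compatibility with the bracket is assumed). Its Levi-Civita connection $\nabla$ is given by $2\langle\nabla_XY,Z\rangle=\langle[X,Y],Z\rangle+\langle[Z,X],Y\rangle+\langle[Z,Y],X\rangle$ for all $X,Y,Z\in\mathfrak g$. A subalgebra $\mathfrak h$ of $\mathfrak g$ is totally geodesic if $\nabla_YZ\in\mathfrak h$ for all $Y,Z\in\mathfrak h$. A nonzero element $Y\in\mathfrak g$ (not necessarily of unit length) is called a geodesic (or geodesic vector) if the one-dimensional subalgebra $\operatorname{Span}(Y)$ is totally geodesic. *)

(* Defs.v *)
From HB Require Import structures.
From mathcomp Require Import all_boot all_order all_algebra.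
From mathcomp Require Import boolp classical_sets reals ring.

Set Implicit Arguments.
Unset Strict Implicit.
Unset Printing Implicit Defensive.
Import Order.TTheory GRing.Theory Num.Theory.
Local Open Scope ring_scope.

HB.mixin Record isLieBracket (R : nzRingType) (g : lmodType R)
    (lie : g -> g -> g) := {
  lie_xx : forall x, lie x x = 0 ;
  lie_jacobi : forall x y z,
    lie x (lie y z) + lie y (lie z x) + lie z (lie x y) = 0
}.

#[short(type="lieBracket")]
HB.structure Definition LieBracket (R : nzRingType) (g : lmodType R) :=
  { lie of @Bilinear R g g g *:%R *:%R lie & @isLieBracket R g lie }.

Section LieAlgebra.
Variables (R : fieldType) (g : vectType R) (lie : lieBracket g).
Implicit Types U V W : {vspace g}.

Definition subalgebra U : Prop := forall x y, x \in U -> y \in U -> lie x y \in U.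

(* The subspace [U, V] spanned by all brackets, see lie_prodP. *)
Definition lie_prod U V : {vspace g} :=
  <<[seq lie u v | u <- vbasis U, v <- vbasis V]>>%VS.

Lemma memv_lie U V u v : u \in U -> v \in V -> lie u v \in lie_prod U V.
Proof.
move=> /coord_vbasis-> /coord_vbasis->.
rewrite linear_sumlz; apply: memv_suml => i _.
rewrite linear_sumr; apply: memv_suml => j _.
rewrite linearZl_LR linearZr_LR; do 2!apply: memvZ; apply: memv_span.
by apply: allpairs_f; rewrite -tnth_nth mem_tnth.
Qed.

Lemma lie_prodP U V W :
  reflect (forall u v, u \in U -> v \in V -> lie u v \in W) (lie_prod U V <= W)%VS.
Proof.
apply: (iffP idP) => [/subvP sW u v uU vV|sW]; first exact/sW/memv_lie.
apply/span_subvP => _ /allpairsP[[u v] /= [uU vV ->]].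
by apply: sW; exact: vbasis_mem.
Qed.

Definition derived_algebra : {vspace g} := lie_prod fullv fullv.

Fixpoint lower_central (n : nat) : {vspace g} :=
  if n is m.+1 then lie_prod fullv (lower_central m) else fullv.

Definition nilpotent_lie : Prop := exists n, lower_central n = 0%VS.

End LieAlgebra.

Section MetricLieAlgebra.
Variables (R : realFieldType) (g : vectType R).
Variables (lie : lieBracket g) (ip : {dot g for idfun}).
Implicit Types X Y Z W : g.

Definition koszul X Y Z : R :=
  ip (lie X Y) Z + ip (lie Z X) Y + ip (lie Z Y) X.

(* The element determined by Koszul's formula, see nablaP and nabla_unique. *)
Definition nabla X Y : g :=
  xget 0 [set W | forall Z, 2 * ip W Z = koszul X Y Z].

Let dotPl a u v Z : ip (a *: u + v) Z = a * ip u Z + ip v Z.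
Proof. exact: (linearPl (ip : {bilinear g -> g -> R | *%R & idfun \; *%R})). Qed.

Let dotPr a u v Z : ip Z (a *: u + v) = a * ip Z u + ip Z v.
Proof. exact: (linearPr (ip : {bilinear g -> g -> R | *%R & idfun \; *%R})). Qed.

Lemma dot_injl W W' : (forall Z, ip W Z = ip W' Z) -> W = W'.
Proof.
move=> eqW; apply/eqP; rewrite -subr_eq0; apply/negPn/negP => nz.
have : 0 < ip (W - W') (W - W') := neq0_dnorm_gt0 _ nz.
have -> : W - W' = (-1) *: W' + W by rewrite scaleN1r addrC.
by rewrite dotPl eqW mulN1r addNr ltxx.
Qed.

Lemma dot_riesz (c : {linear g -> R^o}) : exists W, forall Z, ip W Z = c Z.
Proof.
set n := \dim {:g}; pose e := vbasis {:g}.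
pose f (W : g) := \row_(i < n) ip W e`_i.
have phiL : linear f.
  move=> a u v; apply/rowP => i; rewrite !mxE.
  exact: dotPl.
pose phi0 : {linear g -> 'rV[R]_n} :=
  HB.pack f (GRing.isLinear.Build R g 'rV[R]_n _ f phiL).
pose phi := linfun phi0.
have extE (u v : g -> R^o) : (forall a x y, u (a *: x + y) = a * u x + u y) ->
  (forall a x y, v (a *: x + y) = a * v x + v y) ->
  (forall i : 'I_n, u e`_i = v e`_i) -> forall Z, u Z = v Z.
  move=> uP vP uv Z.
  pose uL : {linear g -> R^o} := HB.pack u (GRing.isLinear.Build R g R^o _ u uP).
  pose vL : {linear g -> R^o} := HB.pack v (GRing.isLinear.Build R g R^o _ v vP).
  rewrite -[u]/(uL : g -> R^o) -[v]/(vL : g -> R^o) (coord_vbasis (memvf Z)).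
  by rewrite !linear_sum; apply: eq_bigr => i _; rewrite !linearZ /= uv.
have ker0 : lker phi == 0%VS.
  apply/lker0P => u v; rewrite !lfunE => /rowP uv.
  apply: dot_injl; apply: extE => // i.
  by have := uv i; rewrite !mxE.
have imT : limg phi = fullv.
  apply/eqP; rewrite eqEdim subvf /= limg_dim_eq; last first.
    by rewrite (eqP ker0) capv0.
  by rewrite !dimvf dim_matrix mul1r /n dimvf.
have : \row_(i < n) (c e`_i : R) \in limg phi by rewrite imT memvf.
case/memv_imgP => W _ /rowP cW; exists W; apply: extE => //.
  by move=> a x y; rewrite linearP.
by move=> i; have := cW i; rewrite lfunE /= !mxE => ->.
Qed.

Lemma nablaP X Y Z : 2 * ip (nabla X Y) Z = koszul X Y Z.
Proof.
pose cf (T : g) : R^o := 2^-1 * koszul X Y T.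
have cL : linear cf.
  move=> a u v; rewrite /cf /koszul.
  have liel S T T' : lie (a *: T + T') S = a *: lie T S + lie T' S.
    exact: linearPl.
  by rewrite !liel dotPr !dotPl /GRing.scale /=; ring.
pose c : {linear g -> R^o} := HB.pack cf (GRing.isLinear.Build R g R^o _ cf cL).
have [W cW] := dot_riesz c.
rewrite /nabla; case: xgetP => [W' _ /(_ Z)//|/(_ W)[]] /= T.
by rewrite cW /= mulrA divff ?mul1r ?pnatr_eq0.
Qed.

Lemma nabla_unique X Y W :
  (forall Z, 2 * ip W Z = koszul X Y Z) -> W = nabla X Y.
Proof.
move=> WP; apply: dot_injl => Z; apply: (@mulfI _ 2); rewrite ?pnatr_eq0 //.
by rewrite WP nablaP.
Qed.

Definition totally_geodesic (h : {vspace g}) : Prop :=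
  subalgebra lie h /\ forall Y Z, Y \in h -> Z \in h -> nabla Y Z \in h.

Definition geodesic_vector (Y : g) : Prop := Y != 0 /\ totally_geodesic <[Y]>%VS.

Record adapted_basis (alpha beta gamma : R) (X1 X2 X3 X4 : g) : Prop := AdaptedBasis {
  adapted_basis_of : basis_of fullv [:: X1; X2; X3; X4] ;
  adapted_orthonormal : orthonormal ip [:: X1; X2; X3; X4] ;
  adapted_alpha_gt0 : 0 < alpha ;
  adapted_gamma_gt0 : 0 < gamma ;
  adapted_lie12 : lie X1 X2 = alpha *: X3 + beta *: X4 ;
  adapted_lie13 : lie X1 X3 = gamma *: X4 ;
  adapted_lie14 : lie X1 X4 = 0 ;
  adapted_lie23 : lie X2 X3 = 0 ;
  adapted_lie24 : lie X2 X4 = 0 ;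
  adapted_lie34 : lie X3 X4 = 0
}.

Definition geodesic_cone (alpha beta gamma : R) (X2 X3 X4 : g) : set g :=
  [set Y | exists x y z : R, Y = x *: X2 + y *: X3 + z *: X4 /\
    alpha * x * y + beta * x * z + gamma * y * z = 0].

End MetricLieAlgebra.

(* Main.v *)
Require Import Defs.
From HB Require Import structures.
From mathcomp Require Import all_boot all_order all_algebra.
From mathcomp Require Import boolp classical_sets reals.
From mathcomp Require Import ring lra.
Import Order.TTheory GRing.Theory Num.Theory.
Local Open Scope ring_scope.
Local Open Scope classical_set_scope.

(** Existence of the basis.  Let D be the derived algebra and C = [g, D].  In a
nilpotent algebra a nonzero subspace is never contained in its own bracket
with g ([nilpotent_perfect_ideal]); hence C is a proper subspace of D, and
[g, C] is a proper subspace of C unless C = 0.  If C were 0, D would be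
central of codimension 2, and all brackets would be multiples of a single one
([dim_derived_central]), against dim D = 2.  So C is a central line.  Take unit
vectors X4 in C and X3 in D orthogonal to C.  The centralizer of X3 has
dimension at least 3, because ad X3 takes values in the line C; so it contains
a unit vector X2 orthogonal to D.  A last unit vector X1 completes the basis,
and every bracket but [X1, X2] in D and [X1, X3] in C vanishes.  The two
coefficients that must be positive are nonzero because dim D = 2; the signs
are adjusted by replacing X2 and X4 by their opposites ([exists_adapted_basis]).

Geodesics.  By Koszul's formula, <nabla_Y Y, Z> = <[Z, Y], Y>.  On an abelian
totally geodesic subspace h the vector nabla_Y Y lies in h and is orthogonal
to h, hence vanishes, so <[Z, Y], Y> = 0 for all Y in h and all Z in g
([totally_geodesic_abelian]).  For a line this condition characterizes geodesic
vectors ([geodesic_vectorP]); written with Z = X1, X2, X3 it becomes three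
polynomial equations in the coordinates of Y ([geodesic_equations]), whose
solutions are the plane <X1, X2> and the cone ([geodesic_locus]).

Planes.  A two-dimensional subalgebra h of a nilpotent algebra is abelian
([nilpotent_plane_abelian]); so if it is totally geodesic, all its nonzero
vectors are geodesic.  If a vector of h had a component on X1, h would be
<X1, X2>, which is not abelian ([abelian_geodesic_plane_orthX1]).  So h is a
plane in <X2, X3, X4> on which the quadratic form of the cone vanishes.  Its
vectors orthogonal to X2 are multiples of X3 or of X4, and polarizing the form
against X3 or X4 gives one linear equation for h, which determines h and
forces beta = 0 ([abelian_geodesic_plane]). *)

Set Implicit Arguments.
Unset Strict Implicit.
Unset Printing Implicit Defensive.

(** * Spans of two vectors and kernels *)

Section Spans.
Variables (K : fieldType) (V : vectType K).
Implicit Types (u v w : V) (U : {vspace V}).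

Lemma span_pairP u v w :
  reflect (exists a b, w = a *: u + b *: v) (w \in <<[:: u; v]>>%VS).
Proof.
rewrite span_cons span_seq1; apply: (iffP memv_addP).
  by case=> _ /vlineP[a ->] [_ /vlineP[b ->] ->]; exists a, b.
case=> a [b ->]; exists (a *: u); first exact/memvZ/memv_line.
by exists (b *: v) => //; exact/memvZ/memv_line.
Qed.

Lemma eq_span_pair U u v :
  \dim U = 2 -> (U <= <<[:: u; v]>>)%VS -> U = <<[:: u; v]>>%VS.
Proof. by move=> dU sU; apply/eqP; rewrite eqEdim sU dU (dim_span [:: u; v]). Qed.

Lemma sub_span_pair U : (\dim U <= 2)%N -> exists u v, (U <= <<[:: u; v]>>)%VS.
Proof.
move=> dU; exists (vbasis U)`_0, (vbasis U)`_1.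
rewrite -{1}(span_basis (vbasisP U)); apply: sub_span => x /(nthP 0)[i].
rewrite size_tuple => /leq_trans/(_ dU) + <-.
by case: i => [|[|//]] _; rewrite !inE eqxx ?orbT.
Qed.

Lemma dim_kernel (f : {linear V -> V}) U : (forall v, f v \in U) ->
  exists2 Z : {vspace V}, (\dim {:V} <= \dim Z + \dim U)%N & {in Z, forall v, f v = 0}.
Proof.
move=> fU; exists (lker (linfun f)) => [|v]; last by rewrite memv_ker lfunE => /eqP.
have <- : (\dim (lker (linfun f)) + \dim (limg (linfun f)))%N = \dim {:V}.
  by have := limg_ker_dim (linfun f) fullv; rewrite capfv.
by rewrite leq_add2l dimvS//; apply/subvP => _ /memv_imgP[v _ ->]; rewrite lfunE fU.
Qed.
End Spans.

(** * Nilpotent Lie algebras *)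

Section NilpotentLieAlgebra.
Variables (K : fieldType) (g : vectType K) (lie : lieBracket g).
Implicit Types (x y z : g) (U V W : {vspace g}).

Lemma lieDl x y z : lie (x + y) z = lie x z + lie y z.
Proof. exact: linearDl. Qed.

Lemma lieZl a x y : lie (a *: x) y = a *: lie x y.
Proof. exact: linearZl_LR. Qed.

Lemma lieDr x y z : lie x (y + z) = lie x y + lie x z.
Proof. exact: linearDr. Qed.

Lemma lieZr a x y : lie x (a *: y) = a *: lie x y.
Proof. exact: linearZr_LR. Qed.

Lemma lieC x y : lie x y = - lie y x.
Proof.
apply/eqP; rewrite -addr_eq0.
by have := lie_xx (s := lie) (x + y); rewrite lieDl !lieDr !lie_xx add0r addr0 => ->.
Qed.

Lemma lie_prodS U U' V V' :
  (U <= U')%VS -> (V <= V')%VS -> (lie_prod lie U V <= lie_prod lie U' V')%VS.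
Proof.
move=> /subvP sU /subvP sV; apply/lie_prodP => u v uU vV.
by apply: memv_lie; [exact: sU|exact: sV].
Qed.

(** By induction such a subspace lies in every term of the lower central series. *)
Lemma nilpotent_perfect_ideal U :
  nilpotent_lie lie -> (U <= lie_prod lie fullv U)%VS -> U = 0%VS.
Proof.
case=> n n0 sU; apply/eqP; rewrite -subv0 -n0.
elim: n {n0} => [|n IHn] /=; first exact: subvf.
exact: subv_trans sU (lie_prodS (subvv _) IHn).
Qed.

(** A nonzero eigenvalue would make the line of w contained in its bracket with g. *)
Lemma nilpotent_eigenvector0 x w c :
  nilpotent_lie lie -> lie x w = c *: w -> c = 0 \/ w = 0.
Proof.
move=> nilg xw; have [->|c0] := eqVneq c 0; [by left|right].
suff wU : (<[w]> <= lie_prod lie fullv <[w]>)%VS.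
  by apply/eqP; rewrite -memv0 -(nilpotent_perfect_ideal nilg wU) memv_line.
rewrite -memvE -[w in w \in _](scalerK c0) -xw memvZ//.
by apply: memv_lie; rewrite ?memvf// memv_line.
Qed.

(** If the plane is spanned by u and v, then [u, v] = a u + b v is an eigenvector
of ad u for b and of ad v for - a; nilpotency gives a = b = 0 or [u, v] = 0. *)
Lemma nilpotent_plane_abelian U : nilpotent_lie lie -> \dim U = 2 ->
  subalgebra lie U -> {in U &, forall x y, lie x y = 0}.
Proof.
move=> nilg dU subU.
have [u [v sU]] : exists u v, (U <= <<[:: u; v]>>)%VS by apply: sub_span_pair; rewrite dU.
have eU := eq_span_pair dU sU.
have uU : u \in U by rewrite eU memv_span ?inE ?eqxx.
have vU : v \in U by rewrite eU memv_span ?inE ?eqxx ?orbT.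
have uv0 : lie u v = 0.
  have /(subvP sU)/span_pairP[a [b E]] := subU _ _ uU vU.
  have Eu : lie u (lie u v) = b *: lie u v.
    by rewrite {1}E lieDr !lieZr lie_xx scaler0 add0r.
  have Ev : lie v (lie u v) = - a *: lie u v.
    by rewrite {1}E lieDr !lieZr lie_xx scaler0 addr0 lieC scalerN scaleNr.
  have [b0|//] := nilpotent_eigenvector0 nilg Eu.
  have [/eqP|//] := nilpotent_eigenvector0 nilg Ev.
  by rewrite oppr_eq0 E b0 => /eqP ->; rewrite !scale0r addr0.
move=> x y /(subvP sU)/span_pairP[a [b ->]] /(subvP sU)/span_pairP[c [d ->]].
by rewrite lieDl !lieDr !lieZl !lieZr !lie_xx (lieC v u) uv0 oppr0 !scaler0 !addr0.
Qed.

(** Brackets only depend on the classes modulo the central subspace U; when the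
quotient is spanned by two vectors, all of them are multiples of one bracket. *)
Lemma dim_derived_central U : lie_prod lie fullv U = 0%VS ->
  (\dim {:g} <= \dim U + 2)%N -> (\dim (derived_algebra lie) <= 1)%N.
Proof.
move=> cU dU.
have zU x z : z \in U -> lie x z = 0.
  by move=> zU; apply/eqP; rewrite -memv0 -cU memv_lie// memvf.
have [e [f sef]] : exists e f, (U^C <= <<[:: e; f]>>)%VS.
  by apply: sub_span_pair; rewrite dimv_compl leq_subLR.
have dec x : exists a b, exists2 z, z \in U & x = a *: e + b *: f + z.
  have : x \in (U + U^C)%VS by rewrite addv_complf memvf.
  case/memv_addP=> z zU1 [w /(subvP sef)/span_pairP[a [b ->]] ->].
  by exists a, b, z; rewrite // addrC.
apply: leq_trans (_ : \dim <[lie e f]>%VS <= 1)%N; last by rewrite dim_vline leq_b1.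
apply: dimvS; apply/lie_prodP => x y _ _.
have [a [b [z zz ->]]] := dec x; have [c [d [t tt ->]]] := dec y.
rewrite lieDr (zU _ t)// addr0 lieDl (lieC z) (zU _ z)// oppr0 addr0.
rewrite lieDl !lieDr !lieZl !lieZr !lie_xx (lieC f e) !scaler0 add0r addr0.
by rewrite rpredD// !rpredZ// ?rpredN memv_line.
Qed.

(** Rank-nullity for ad x. *)
Lemma dim_centralizer x U : (forall y, lie x y \in U) ->
  exists2 Z : {vspace g}, (\dim {:g} <= \dim Z + \dim U)%N & {in Z, forall y, lie x y = 0}.
Proof.
have adL : linear (lie x) by move=> c u v; rewrite lieDr lieZr.
move: (lie x : g -> g) adL => ad adL xU.
(* ad x becomes a variable, so that its linear structure can be built from the
   class of the vector space rather than from the bilinear bracket. *)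
pose adM := GRing.isLinear.Build K g g _ ad adL.
exact: (@dim_kernel _ _ (HB.pack_for {linear g -> g} ad adM)).
Qed.

End NilpotentLieAlgebra.
Arguments lieC {K g lie}.

(** * Orthonormal families *)

Section InnerProduct.
Variables (R : realFieldType) (g : vectType R) (ip : {dot g for idfun}).
Implicit Types (u v w : g) (U V : {vspace g}).

Lemma ipC u v : ip u v = ip v u.
Proof. by rewrite hermC mul1r. Qed.

Lemma ipDl u v w : ip (u + v) w = ip u w + ip v w.
Proof. exact: linearDl. Qed.

Lemma ipZl a u v : ip (a *: u) v = a * ip u v.
Proof. exact: linearZl_LR. Qed.

Lemma ipDr u v w : ip w (u + v) = ip w u + ip w v.
Proof. by rewrite ipC ipDl !(ipC w). Qed.

Lemma ipZr a u v : ip v (a *: u) = a * ip v u.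
Proof. by rewrite ipC ipZl ipC. Qed.

Lemma ip0l u : ip 0 u = 0.
Proof. by rewrite -(scale0r 0) ipZl mul0r. Qed.

Lemma ip_eq0 u : (ip u u == 0) = (u == 0).
Proof.
apply/eqP/eqP => [|->]; last exact: ip0l.
by apply: contra_eq => /(neq0_dnorm_gt0 (s := ip))/gt_eqF/negbT.
Qed.

(** A vector of the span of the family is orthogonal to the first vector v, so it
cannot be v itself. *)
Lemma orthonormal_real_free s : orthonormal ip s -> free s.
Proof.
elim: s => [|v s IHs]; first by rewrite nil_free.
rewrite /orthonormal /= => /andP[/andP[/eqP v1 s1]] /andP[vs os].
rewrite free_cons IHs; last by rewrite /orthonormal s1.
rewrite andbT; apply/negP => vin.
have /orthovP/(_ v v) : (<<[:: v]>> <= orthov ip <<s>>)%VS by rewrite -orthogonalE.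
rewrite memv_span1 => /(_ isT vin) vv0.
by have /eqP := etrans (esym v1) vv0; rewrite oner_eq0.
Qed.

Lemma orthonormal_basis U s : orthonormal ip s -> {subset s <= U} ->
  (\dim U <= size s)%N -> basis_of U s.
Proof.
move=> os sU dU; rewrite basisEfree orthonormal_real_free// dU andbT.
exact/span_subvP.
Qed.

(** Each new condition of orthogonality lowers the dimension by at most one. *)
Lemma dim_cap_orthov U s : (\dim U - size s <= \dim (U :&: orthov ip <<s>>))%N.
Proof.
elim: s => [|v s IHs]; first by rewrite span_nil orthov0 capvf subn0.
apply: leq_trans (_ : (\dim ((U :&: orthov ip <<s>>) :&: orthov ip <[v]>) <= _)%N).
  apply: leq_trans (leq_dim_orthov1 _ _ _).
  by rewrite /= subnS -!subn1 leq_sub2r.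
apply: dimvS; apply/subvP => x; rewrite !memv_cap => /andP[/andP[-> xs] xv] /=.
by rewrite memvE span_cons orthovD -!memvE xv.
Qed.

Lemma exists_orthov U V : (\dim V < \dim U)%N ->
  exists v, [/\ v \in U, v != 0 & {in V, forall w, ip v w = 0}].
Proof.
move=> dVU; pose W := (U :&: orthov ip V)%VS.
have W0 : W != 0%VS.
  have := dim_cap_orthov U (vbasis V).
  rewrite size_tuple (span_basis (vbasisP V)) -/W -dimv_eq0 -lt0n.
  by apply: leq_trans; rewrite subn_gt0.
have := memv_pick W; rewrite memv_cap => /andP[wU /mem_orthovP wV].
by exists (vpick W); rewrite vpick0.
Qed.

Lemma exists_orthov1 U u : \dim U = 2 -> exists v, [/\ v \in U, v != 0 & ip v u = 0].
Proof.
move=> dU; have [|v [vU v0 vu]] := @exists_orthov U <[u]>.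
  by rewrite dU dim_vline ltnS leq_b1.
by exists v; split=> //; rewrite vu// memv_line.
Qed.
End InnerProduct.
Arguments ipC {R g ip}.

(** The tool that builds orthonormal bases one vector at a time; normalizing
needs a square root, whence the real closed field. *)
Lemma exists_unit_orthov (R : rcfType) (g : vectType R) (ip : {dot g for idfun})
    (U V : {vspace g}) : (\dim V < \dim U)%N ->
  exists v, [/\ v \in U, ip v v = 1 & {in V, forall w, ip v w = 0}].
Proof.
move=> /(exists_orthov ip)[w [wU w0 wV]].
have w_gt0 : 0 < ip w w := neq0_dnorm_gt0 w w0.
exists ((Num.sqrt (ip w w))^-1 *: w); split; first exact: memvZ.
  rewrite ipZl ipZr mulrA -invfM -expr2 sqr_sqrtr ?ltW// mulVf//.
  by rewrite gt_eqF.
by move=> v vV; rewrite ipZl (wV v vV : ip w v = 0) mulr0.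
Qed.

(** * The geodesic condition *)

Section TotallyGeodesic.
Variables (R : realFieldType) (g : vectType R).
Variables (lie : lieBracket g) (ip : {dot g for idfun}).
Implicit Types (X Y Z : g) (h : {vspace g}).

(** Koszul's formula gives <nabla_Y Y, Z> = <[Z, Y], Y>.  Taking Z = nabla_Y Y,
which lies in h, the bracket vanishes, so nabla_Y Y has norm zero. *)
Lemma totally_geodesic_abelian h : {in h &, forall Y Z, lie Y Z = 0} ->
  totally_geodesic lie ip h -> {in h, forall Y Z, ip (lie Z Y) Y = 0}.
Proof.
move=> abh [_ tgh] Y Yh.
have nYY Z : ip (nabla lie ip Y Y) Z = ip (lie Z Y) Y.
  apply: (@mulfI _ 2); rewrite ?pnatr_eq0// nablaP /koszul lie_xx ip0l.
  by rewrite add0r mulr_natl mulr2n.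
have /eqP : ip (nabla lie ip Y Y) (nabla lie ip Y Y) = 0.
  by rewrite nYY (abh _ _ (tgh _ _ Yh Yh) Yh) ip0l.
by rewrite ip_eq0 => /eqP n0 Z; rewrite -nYY n0 ip0l.
Qed.

Lemma geodesic_vectorP Y :
  geodesic_vector lie ip Y <-> Y != 0 /\ forall Z, ip (lie Z Y) Y = 0.
Proof.
have abY : {in <[Y]>%VS &, forall U V, lie U V = 0}.
  by move=> _ _ /vlineP[a ->] /vlineP[b ->]; rewrite lieZl lieZr lie_xx !scaler0.
split=> -[Y0 tgY]; split=> //.
  exact: totally_geodesic_abelian abY tgY _ (memv_line Y).
split=> [U V Uh Vh|_ _ /vlineP[a ->] /vlineP[b ->]]; first by rewrite abY// mem0v.
rewrite -(@nabla_unique _ _ lie ip (a *: Y) (b *: Y) 0) ?mem0v// => Z.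
rewrite ip0l mulr0 /koszul lieZl !lieZr lie_xx !scaler0 ip0l.
by rewrite !ipZl !ipZr !tgY !mulr0 !addr0.
Qed.
End TotallyGeodesic.

(** * Coordinates in an adapted basis *)

(** The relations of an adapted basis without the sign conditions, so that the
formulas below can be used to prove that the coefficients are nonzero. *)
Record bracket_table (R : realFieldType) (g : vectType R) (lie : lieBracket g)
    (a b c : R) (X1 X2 X3 X4 : g) : Prop := BracketTable {
  table12 : lie X1 X2 = a *: X3 + b *: X4;
  table13 : lie X1 X3 = c *: X4;
  table14 : lie X1 X4 = 0;
  table23 : lie X2 X3 = 0;
  table24 : lie X2 X4 = 0;
  table34 : lie X3 X4 = 0 }.

Section Coordinates.
Variables (R : realFieldType) (g : vectType R).
Variables (lie : lieBracket g) (ip : {dot g for idfun}).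
Variables (a b c : R) (X1 X2 X3 X4 : g).
Implicit Types (Y Z W : g) (h : {vspace g}).

Hypothesis basisX : basis_of fullv [:: X1; X2; X3; X4].
Hypothesis orthoX : orthonormal ip [:: X1; X2; X3; X4].
Hypothesis lieX : bracket_table lie a b c X1 X2 X3 X4.

Lemma orthonormal4P :
  [/\ ip X1 X1 = 1, ip X2 X2 = 1, ip X3 X3 = 1 & ip X4 X4 = 1] /\
  [/\ ip X1 X2 = 0, ip X1 X3 = 0 & ip X1 X4 = 0] /\
  [/\ ip X2 X3 = 0, ip X2 X4 = 0 & ip X3 X4 = 0].
Proof.
move: orthoX; rewrite /orthonormal /= !andbT.
case/andP=> /and4P[/eqP ? /eqP ? /eqP ? /eqP ?].
case/and3P=> /and3P[/eqP ? /eqP ? /eqP ?] /andP[/eqP ? /eqP ?] /eqP ?.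
by split; [|split]; split.
Qed.

Lemma coordE Y : Y = ip Y X1 *: X1 + ip Y X2 *: X2 + ip Y X3 *: X3 + ip Y X4 *: X4.
Proof.
have [[e11 e22 e33 e44] [[e12 e13 e14] [e23 e24 e34]]] := orthonormal4P.
have : Y \in <<[:: X1; X2; X3; X4]>>%VS by rewrite (span_basis basisX) memvf.
rewrite span_cons => /memv_addP[_ /vlineP[x1 ->] [V]].
rewrite span_cons => /memv_addP[_ /vlineP[x2 ->] [W /span_pairP[x3 [x4 ->]] ->]] ->.
rewrite !ipDl !ipZl e11 e22 e33 e44 (ipC X2 X1) (ipC X3 X1) (ipC X4 X1).
rewrite (ipC X3 X2) (ipC X4 X2) (ipC X4 X3) e12 e13 e14 e23 e24 e34.
by rewrite !mulr0 !mulr1 !addr0 !add0r !addrA.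
Qed.

Lemma ip_lie Y Z W : ip (lie Y Z) W =
  (ip Y X1 * ip Z X2 - ip Y X2 * ip Z X1) * (a * ip X3 W + b * ip X4 W) +
  (ip Y X1 * ip Z X3 - ip Y X3 * ip Z X1) * (c * ip X4 W).
Proof.
have [t12 t13 t14 t23 t24 t34] := lieX.
rewrite {1}(coordE Y) {1}(coordE Z) !lieDl !lieDr !lieZl !lieZr !lie_xx.
rewrite (lieC X2 X1) (lieC X3 X1) (lieC X4 X1) (lieC X3 X2) (lieC X4 X2) (lieC X4 X3).
rewrite t12 t13 t14 t23 t24 t34 -!scaleN1r !ipDl !ipZl !ipDl !ipZl !ip0l; ring.
Qed.

Lemma lieE Y Z : lie Y Z =
  (ip Y X1 * ip Z X2 - ip Y X2 * ip Z X1) *: (a *: X3 + b *: X4) +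
  (ip Y X1 * ip Z X3 - ip Y X3 * ip Z X1) *: (c *: X4).
Proof. by apply: (dot_injl (ip := ip)) => W; rewrite ip_lie !ipDl !ipZl !ipDl !ipZl. Qed.

(** The three equations are those for Z = X1, X2, X3, up to sign; X4 is central
and gives none. *)
Lemma geodesic_equations Y : (forall Z, ip (lie Z Y) Y = 0) <->
  [/\ ip Y X2 * (a * ip Y X3 + b * ip Y X4) + c * ip Y X3 * ip Y X4 = 0,
      ip Y X1 * (a * ip Y X3 + b * ip Y X4) = 0 & ip Y X1 * (c * ip Y X4) = 0].
Proof.
have [[e11 e22 e33 e44] [[e12 e13 e14] [e23 e24 e34]]] := orthonormal4P.
split=> [E|[E1 E2 E3] Z]; last first.
  rewrite ip_lie !(ipC _ Y).
  transitivity (ip Z X1 * (ip Y X2 * (a * ip Y X3 + b * ip Y X4) + c * ip Y X3 * ip Y X4)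
    - ip Z X2 * (ip Y X1 * (a * ip Y X3 + b * ip Y X4))
    - ip Z X3 * (ip Y X1 * (c * ip Y X4))); first by rewrite !(ipC Y); ring.
  by rewrite E1 E2 E3 !mulr0 !subr0.
have := E X1; have := E X2; have := E X3; rewrite !ip_lie !(ipC _ Y).
rewrite !(ipC X2 X1) !(ipC X3 X1) (ipC X3 X2) e11 e22 e33 e12 e13 e23.
by split; lra.
Qed.

Lemma ip_comb x1 x2 x3 x4 (Y := x1 *: X1 + x2 *: X2 + x3 *: X3 + x4 *: X4) :
  [/\ ip Y X1 = x1, ip Y X2 = x2, ip Y X3 = x3 & ip Y X4 = x4].
Proof.
have [[e11 e22 e33 e44] [[e12 e13 e14] [e23 e24 e34]]] := orthonormal4P.
rewrite /Y !ipDl !ipZl e11 e22 e33 e44 (ipC X2 X1) (ipC X3 X1) (ipC X4 X1).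
rewrite (ipC X3 X2) (ipC X4 X2) (ipC X4 X3) e12 e13 e14 e23 e24 e34.
by split; ring.
Qed.

Lemma mem_span12 Y : Y \in <<[:: X1; X2]>>%VS <-> ip Y X3 = 0 /\ ip Y X4 = 0.
Proof.
split=> [/span_pairP[x [y ->]]|[Y3 Y4]]; last first.
  apply/span_pairP; exists (ip Y X1), (ip Y X2).
  by rewrite {1}(coordE Y) Y3 Y4 !scale0r !addr0.
by have [] := ip_comb x y 0 0; rewrite !scale0r !addr0.
Qed.

Lemma mem_geodesic_cone Y : geodesic_cone a b c X2 X3 X4 Y <->
  ip Y X1 = 0 /\ ip Y X2 * (a * ip Y X3 + b * ip Y X4) + c * ip Y X3 * ip Y X4 = 0.
Proof.
split=> [[x [y [z [-> E]]]]|[Y1 E]].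
  have [] := ip_comb 0 x y z; rewrite scale0r add0r => -> -> -> ->.
  by split=> //; rewrite -E; ring.
exists (ip Y X2), (ip Y X3), (ip Y X4); split; last by rewrite -E; ring.
by rewrite {1}(coordE Y) Y1 scale0r add0r.
Qed.

Hypotheses (a0 : a != 0) (c0 : c != 0).

(** If the X1-coordinate is nonzero, the last two geodesic equations kill the
coordinates on X4 and then X3; if it is zero, the first one is the cone. *)
Lemma geodesic_locus Y : (forall Z, ip (lie Z Y) Y = 0) <->
  Y \in <<[:: X1; X2]>>%VS \/ geodesic_cone a b c X2 X3 X4 Y.
Proof.
split=> [/geodesic_equations[E1 E2 E3]|YP]; last first.
  apply/geodesic_equations; case: YP => [/mem_span12[-> ->]|/mem_geodesic_cone[-> ->]].
    by split; ring.
  by split; ring.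
have [Y1|Y1] := eqVneq (ip Y X1) 0; first by right; apply/mem_geodesic_cone.
left; apply/mem_span12.
move/eqP: E3; rewrite !mulf_eq0 (negPf Y1) (negPf c0) /= => /eqP Y4.
move/eqP: E2; rewrite Y4 mulr0 addr0 !mulf_eq0 (negPf Y1) (negPf a0) /= => /eqP Y3.
by [].
Qed.

Lemma lie_orthov : (<<[:: X1; X2]>> <= orthov ip (derived_algebra lie))%VS.
Proof.
rewrite orthov_sym; apply/lie_prodP => Y Z _ _; apply/mem_orthovP => W WX.
rewrite [LHS]ip_lie !(ipC _ W).
by have [-> ->] := iffLR (mem_span12 W) WX; ring.
Qed.

(** Let Y in h have a nonzero X1-coordinate, and let v in h be nonzero and
orthogonal to X1.  Then Y and Y + v both lie in <X1, X2>, so v is a multiple of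
X2; but [Y, v] = 0 then forces v = 0. *)
Lemma abelian_geodesic_plane_orthX1 h : \dim h = 2 ->
  {in h &, forall Y Z, lie Y Z = 0} -> {in h, forall Y Z, ip (lie Z Y) Y = 0} ->
  {in h, forall Y, ip Y X1 = 0}.
Proof.
move=> dh abh tgh Y Yh; apply/eqP/negPn/negP => Y1.
have in12 Z : Z \in h -> ip Z X1 != 0 -> ip Z X3 = 0 /\ ip Z X4 = 0.
  move=> Zh Z1; have [/mem_span12//|/mem_geodesic_cone[Z10]] :=
    iffLR (geodesic_locus Z) (tgh Z Zh).
  by rewrite Z10 eqxx in Z1.
have [v [vh v0 v1]] := exists_orthov1 ip X1 dh.
have [Y3 Y4] := in12 _ Yh Y1.
have [] := in12 (Y + v); first exact: rpredD.
  by rewrite ipDl v1 addr0.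
rewrite !ipDl Y3 Y4 !add0r => v3 v4.
have /(congr1 (ip^~ X3)) := abh _ _ Yh vh.
have [[_ _ e33 _] [_ [_ _ e34]]] := orthonormal4P.
rewrite /= ip0l ip_lie v1 v3 Y3 e33 (ipC X4 X3) e34 => /eqP.
rewrite !mulr0 !subr0 addr0 mulr1 addr0 !mulf_eq0 (negPf Y1) (negPf a0) orbF /= => /eqP v2.
by move: v0; rewrite (coordE v) v1 v2 v3 v4 !scale0r !addr0 eqxx.
Qed.

(** For v in h orthogonal to X2 the cone reduces to c v3 v4 = 0, so h contains X4
or X3.  Comparing the cone at Y and at Y + X4 (or Y + X3) gives a linear equation
satisfied by every Y in h. *)
Lemma abelian_geodesic_plane h : \dim h = 2 ->
  {in h &, forall Y Z, lie Y Z = 0} -> {in h, forall Y Z, ip (lie Z Y) Y = 0} ->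
  b = 0 /\ (h = <<[:: X2; X4]>>%VS \/ h = <<[:: c *: X2 - a *: X4; X3]>>%VS).
Proof.
move=> dh abh tgh.
have h1 := abelian_geodesic_plane_orthX1 dh abh tgh.
have cone Y : Y \in h ->
    ip Y X2 * (a * ip Y X3 + b * ip Y X4) + c * ip Y X3 * ip Y X4 = 0.
  by move=> /tgh/geodesic_equations[].
have [[_ e22 e33 e44] [_ [e23 e24 e34]]] := orthonormal4P.
have coord3 Y : Y \in h -> Y = ip Y X2 *: X2 + ip Y X3 *: X3 + ip Y X4 *: X4.
  by move=> Yh; rewrite {1}(coordE Y) h1// scale0r add0r.
have [v [vh v0 v2]] := exists_orthov1 ip X2 dh.
have := cone v vh; rewrite v2 mul0r add0r => /eqP.
rewrite !mulf_eq0 (negPf c0) /= => /orP[/eqP v3|/eqP v4].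
  (* v is a multiple of X4 *)
  have ve := coord3 v vh; rewrite v2 v3 !scale0r !add0r in ve.
  have v40 : ip v X4 != 0 by apply: contraNneq v0 => v4; rewrite ve v4 scale0r.
  have X4h : X4 \in h by rewrite -[X4](scalerK v40) -ve memvZ.
  have lin Y : Y \in h -> b * ip Y X2 + c * ip Y X3 = 0.
    move=> Yh; have := cone _ (rpredD Yh X4h); have := cone Y Yh.
    by rewrite !ipDl (ipC X4 X2) (ipC X4 X3) e24 e34 e44 => + E; move: E; lra.
  have [w [wh w0 w4]] := exists_orthov1 ip X4 dh.
  have := cone w wh; rewrite w4 !mulr0 !addr0 => wc.
  have wl := lin w wh.
  have w3 : ip w X3 = 0.
    move/eqP: wc; rewrite !mulf_eq0 (negPf a0) /= => /orP[/eqP w2|/eqP//].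
    by move/eqP: wl; rewrite w2 mulr0 add0r mulf_eq0 (negPf c0) /= => /eqP.
  have w2 : ip w X2 != 0.
    by apply: contraNneq w0 => w2; rewrite (coord3 w wh) w2 w3 w4 !scale0r !addr0.
  have bE : b = 0.
    by move/eqP: wl; rewrite w3 mulr0 addr0 mulf_eq0 (negPf w2) orbF => /eqP.
  split=> //; left; apply: eq_span_pair dh _; apply/subvP => Y Yh.
  have /eqP := lin Y Yh; rewrite bE mul0r add0r mulf_eq0 (negPf c0) /= => /eqP Y3.
  apply/span_pairP; exists (ip Y X2), (ip Y X4).
  by rewrite {1}(coord3 Y Yh) Y3 scale0r addr0.
(* v is a multiple of X3 *)
have ve := coord3 v vh; rewrite v2 v4 !scale0r add0r addr0 in ve.
have v30 : ip v X3 != 0 by apply: contraNneq v0 => v3; rewrite ve v3 scale0r.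
have X3h : X3 \in h by rewrite -[X3](scalerK v30) -ve memvZ.
have lin Y : Y \in h -> a * ip Y X2 + c * ip Y X4 = 0.
  move=> Yh; have := cone _ (rpredD Yh X3h); have := cone Y Yh.
  by rewrite !ipDl (ipC X3 X2) e23 e34 e33 => + E; move: E; lra.
have [w [wh w0 w3]] := exists_orthov1 ip X3 dh.
have wl := lin w wh.
have w2 : ip w X2 != 0.
  apply: contraNneq w0 => w2; move/eqP: wl.
  rewrite w2 mulr0 add0r mulf_eq0 (negPf c0) /= => /eqP w4.
  by rewrite (coord3 w wh) w2 w3 w4 !scale0r !addr0.
have w4 : ip w X4 != 0.
  apply: contraNneq w2 => w4; move/eqP: wl.
  by rewrite w4 mulr0 addr0 mulf_eq0 (negPf a0).
split.
  have /eqP := cone w wh; rewrite w3 !mulr0 mul0r add0r addr0.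
  by rewrite !mulf_eq0 (negPf w2) (negPf w4) orbF => /eqP.
right; apply: eq_span_pair dh _; apply/subvP => Y Yh.
apply/span_pairP; exists (c^-1 * ip Y X2), (ip Y X3).
have Y4 : ip Y X4 = - (c^-1 * ip Y X2 * a).
  by apply: (mulfI c0); have /eqP := lin Y Yh; rewrite addrC addr_eq0 => /eqP ->; field.
rewrite {1}(coord3 Y Yh) Y4 scalerBr !scalerA [c^-1 * _ * c]mulrAC mulVf// mul1r.
by rewrite scaleNr addrAC.
Qed.

End Coordinates.

(** * Existence of an adapted basis *)

Lemma exists_adapted_basis (R : rcfType) (g : vectType R)
    (lie : lieBracket g) (ip : {dot g for idfun}) :
  \dim {:g} = 4 -> nilpotent_lie lie -> \dim (derived_algebra lie) = 2 ->
  exists (a b c : R) (X1 X2 X3 X4 : g), adapted_basis lie ip a b c X1 X2 X3 X4.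
Proof.
move=> dg nilg dD; set D := derived_algebra lie in dD.
pose C := lie_prod lie fullv D; pose C' := lie_prod lie fullv C.
have sCD : (C <= D)%VS := lie_prodS lie (subvv _) (subvf D).
have sC'C : (C' <= C)%VS := lie_prodS lie (subvv _) sCD.
have dC : \dim C = 1.
  have dC2 : (\dim C < 2)%N.
    rewrite ltnNge; apply/negP => dDC.
    have : (D <= C)%VS by rewrite -(geq_leqif (dimv_leqif_sup sCD)) dD.
    by move/(nilpotent_perfect_ideal nilg) => D0; rewrite D0 dimv0 in dD.
  have : \dim C != 0; last by case: (\dim C) dC2 => [|[]].
  apply/eqP => /eqP; rewrite dimv_eq0 => /eqP C0.
  by have := dim_derived_central C0; rewrite dg -/D dD => /(_ isT).
have C'0 : C' = 0%VS.
  apply/eqP; rewrite -dimv_eq0; have := dimv_leqif_sup sC'C; rewrite dC.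
  case=> + _; rewrite leq_eqVlt ltnS leqn0 => /orP[/eqP dC'|//].
  have : (C <= C')%VS by rewrite -(geq_leqif (dimv_leqif_sup sC'C)) dC dC'.
  by move/(nilpotent_perfect_ideal nilg) => C0; rewrite C0 dimv0 in dC.
have zC x z : z \in C -> lie x z = 0.
  by move=> zC; apply/eqP; rewrite -memv0 -C'0 memv_lie ?memvf.
have [X4 [X4C e44 _]] := @exists_unit_orthov _ _ ip C 0 ltac:(by rewrite dimv0 dC).
have [X3 [X3D e33 X3C]] := @exists_unit_orthov _ _ ip D C ltac:(by rewrite dC dD).
have [X2 [X2K e22 X2D]] : exists X2, [/\ lie X3 X2 = 0, ip X2 X2 = 1
    & {in D, forall w, ip X2 w = 0}].
  have [|Z dZ cZ] := @dim_centralizer _ _ lie X3 C.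
    by move=> y; rewrite lieC memvN memv_lie ?memvf.
  have dDZ : (\dim D < \dim Z)%N by move: dZ; rewrite dg dC dD addn1 ltnS.
  by have [X2 [X2Z e22 X2D]] := exists_unit_orthov ip dDZ; exists X2; rewrite cZ.
have dD2 : (\dim (D + <[X2]>) < \dim {:g})%N.
  rewrite dg ltnS; apply: leq_trans (dimv_add_leqif _ _) _.
  by rewrite dD dim_vline; case: (_ != _).
have [X1 [_ e11 X1D2]] := exists_unit_orthov ip dD2.
have X1D w : w \in D -> ip X1 w = 0 by move=> wD; apply/X1D2/(subvP (addvSl _ _)).
have e12 : ip X1 X2 = 0 by apply/X1D2/(subvP (addvSr _ _))/memv_line.
have X4D := subvP sCD _ X4C.
have e34 : ip X3 X4 = 0 := X3C _ X4C.
have e13 : ip X1 X3 = 0 := X1D _ X3D.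
have e14 : ip X1 X4 = 0 := X1D _ X4D.
have e23 : ip X2 X3 = 0 := X2D _ X3D.
have e24 : ip X2 X4 = 0 := X2D _ X4D.
(* Stated with signs s and t on X2 and X4 because it is needed twice: for the
   initial basis, and after the coefficients have been made positive. *)
have basis4 (s t : R) : s ^+ 2 = 1 -> t ^+ 2 = 1 ->
    orthonormal ip [:: X1; s *: X2; X3; t *: X4] /\
    basis_of fullv [:: X1; s *: X2; X3; t *: X4].
  move=> s2 t2; suff o : orthonormal ip [:: X1; s *: X2; X3; t *: X4].
    by split=> //; apply: orthonormal_basis o _ _ => [x _|]; rewrite ?memvf ?dg.
  rewrite /orthonormal /= !ipZl !ipZr e11 e22 e33 e44 e12 e13 e14 e23 e24 e34.
  by rewrite !mulr0 !mulr1 -!expr2 s2 t2 !eqxx.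
have [orthoX basisX] := basis4 1 1 (expr1n _ _) (expr1n _ _).
rewrite !scale1r in orthoX basisX.
have basisD : basis_of D [:: X3; X4].
  apply: (orthonormal_basis (ip := ip)); rewrite ?dD//.
    by rewrite /orthonormal /= e33 e44 e34 !eqxx.
  by move=> x; rewrite !inE => /orP[]/eqP->.
have basisC : basis_of C [:: X4].
  apply: (orthonormal_basis (ip := ip)); rewrite ?dC//; first by rewrite /orthonormal /= e44 eqxx.
  by move=> x; rewrite !inE => /eqP->.
have [a [b t12]] : exists a b, lie X1 X2 = a *: X3 + b *: X4.
  by apply/span_pairP; rewrite (span_basis basisD) memv_lie ?memvf.
have [c t13] : exists c, lie X1 X3 = c *: X4.
  by apply/vlineP; rewrite -span_seq1 (span_basis basisC) memv_lie ?memvf.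
have table : bracket_table lie a b c X1 X2 X3 X4.
  by split; rewrite // ?(zC _ X4 X4C)//; rewrite lieC X2K oppr0.
have lie2 := lieE basisX orthoX table.
(* The derived algebra is a plane, so no line contains all brackets. *)
have sDline u : (forall Y Z, lie Y Z \in <[u]>%VS) -> False.
  move=> hu; have /dimvS : (D <= <[u]>)%VS by apply/lie_prodP => Y Z _ _.
  by rewrite dD dim_vline; case: (_ != _).
have a0 : a != 0.
  apply/eqP => a0; apply: (sDline X4) => Y Z.
  by rewrite lie2 a0 scale0r add0r rpredD// !rpredZ// memv_line.
have c0 : c != 0.
  apply/eqP => c0; apply: (sDline (a *: X3 + b *: X4)) => Y Z.
  by rewrite lie2 c0 scale0r scaler0 addr0 rpredZ// memv_line.
have sg2 (x : R) : x != 0 -> Num.sg x ^+ 2 = 1 by move=> x0; rewrite sqr_sg x0.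
have [orthoS basisS] := basis4 _ _ (sg2 _ a0) (sg2 _ c0).
exists `|a|, (Num.sg a * b * Num.sg c), `|c|, X1, (Num.sg a *: X2), X3, (Num.sg c *: X4).
have [_ _ t14 t23 t24 t34] := table.
split; rewrite ?normr_gt0// ?lieZl ?lieZr ?t12 ?t13 ?t14 ?t23 ?t24 ?t34 ?scaler0//.
  rewrite scalerDr !scalerA -normrEsg -(mulrA _ (Num.sg c)) -expr2 sg2//.
  by rewrite mulr1.
by rewrite scalerA mulrC -numEsg.
Qed.

(** * Geodesics and totally geodesic planes *)

Theorem proposition1p12 (R : realType) (g : vectType R)
    (lie : lieBracket g) (ip : {dot g for idfun}) :
  \dim {:g} = 4%N ->
  nilpotent_lie lie ->
  \dim (derived_algebra lie) = 2%N ->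
  (exists (alpha beta gamma : R) (X1 X2 X3 X4 : g),
    adapted_basis lie ip alpha beta gamma X1 X2 X3 X4) /\
  (forall (alpha beta gamma : R) (X1 X2 X3 X4 : g),
    adapted_basis lie ip alpha beta gamma X1 X2 X3 X4 ->
    [/\ [set Y | geodesic_vector lie ip Y] =
          [set Y | Y != 0] `&`
            ([set` <<[:: X1; X2]>>%VS] `|` geodesic_cone alpha beta gamma X2 X3 X4),
        (<<[:: X1; X2]>> <= orthov ip (derived_algebra lie))%VS,
        geodesic_cone alpha beta gamma X2 X3 X4 `<=` [set` <<[:: X2; X3; X4]>>%VS]
      & forall h : {vspace g}, \dim h = 2%N -> totally_geodesic lie ip h ->
          beta = 0 /\
          (h = <<[:: X2; X4]>>%VS \/
           h = <<[:: gamma *: X2 - alpha *: X4; X3]>>%VS)]).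
Proof.
move=> dg nilg dD; split; first exact: exists_adapted_basis.
move=> a b c X1 X2 X3 X4 [basisX orthoX /lt0r_neq0 a0 /lt0r_neq0 c0 t12 t13 t14 t23 t24 t34].
have lieX : bracket_table lie a b c X1 X2 X3 X4 by [].
split.
- apply/seteqP; split=> Y /=.
    by move=> /geodesic_vectorP[Y0 /(geodesic_locus basisX orthoX lieX a0 c0)].
  by move=> [Y0 /(geodesic_locus basisX orthoX lieX a0 c0) YP]; apply/geodesic_vectorP.
- exact: lie_orthov basisX orthoX lieX.
- move=> _ [x [y [z [-> _]]]] /=.
  by rewrite !rpredD// rpredZ// memv_span// !inE eqxx ?orbT.
- move=> h dh tgh.
  have abh := nilpotent_plane_abelian nilg dh (proj1 tgh).
  apply: (abelian_geodesic_plane basisX orthoX lieX a0 c0 dh abh).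
  exact: totally_geodesic_abelian abh tgh.
Qed.
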